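(* Let $d\ge 1$ and let $(X,T,\mathbb{Z}^d)$ be a topological dynamical system with $X$ infinite. Then the intersection of all its nonexpansive open half-spaces of $\mathbb{R}^d$ is empty.
   Context: A topological dynamical system $(X,T,\mathbb{Z}^d)$ is an action of $\mathbb{Z}^d$ by homeomorphisms $T_g$, $g\in\mathbb{Z}^d$, on a compact metric space $X$ with distance $\operatorname{dist}$. For a unit vector $v\in\mathbb{S}^{d-1}\subseteq\mathbb{R}^d$ consider the open half-space $H_v=\{u\in\mathbb{R}^d:\langle u,v\rangle<0\}$ (Euclidean inner product). The half-space $H_v$ is nonexpansive for $(X,T,\mathbb{Z}^d)$ if for every $\epsilon>0$ there exist two different points $x,y\in X$ such that $\operatorname{dist}(T_gx,T_gy)\le\epsilon$ for all $g\in H_v\cap\mathbb{Z}^d$. *)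

(* Defs.v *)
From HB Require Import structures.
From mathcomp Require Import all_boot all_order all_algebra.
From mathcomp Require Import all_classical all_reals all_analysis.

Set Implicit Arguments.
Unset Strict Implicit.
Unset Printing Implicit Defensive.

Import Order.TTheory GRing.Theory Num.Theory.
Local Open Scope classical_set_scope.
Local Open Scope ring_scope.

Definition homeomorphism (X Y : topologicalType) (f : X -> Y) : Prop :=
  continuous f /\
  exists g : Y -> X, [/\ continuous g, cancel f g & cancel g f].

Record Zd_action (d : nat) (X : topologicalType) := ZdAction {
  act :> 'rV[int]_d -> X -> X;
  act0 : forall x, act 0 x = x;
  actD : forall g h x, act (g + h) x = act g (act h x);
  act_homeo : forall g, homeomorphism (act g)
}.

Definition dot (R : realType) (d : nat) (u v : 'rV[R]_d) : R :=
  \sum_(i < d) u ord0 i * v ord0 i.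

(* The norm `|v| that MathComp puts on matrices is the sup norm, so the
   Euclidean norm has to be spelled out. *)
Definition unit_sphere (R : realType) (d : nat) : set 'rV[R]_d :=
  [set v | Num.sqrt (dot v v) = 1].

Definition half_space (R : realType) (d : nat) (v : 'rV[R]_d) : set 'rV[R]_d :=
  [set u | dot u v < 0].

Definition nonexpansive (R : realType) (d : nat) (X : metricType R)
    (T : Zd_action d X) (H : set 'rV[R]_d) : Prop :=
  forall eps : R, 0 < eps ->
    exists x y : X, x <> y /\
      forall g : 'rV[int]_d, H (map_mx intr g) -> mdist (T g x) (T g y) <= eps.

(* Main.v *)
Require Import Defs.
From mathcomp Require Import all_boot all_order all_algebra.
From mathcomp Require Import all_classical all_reals all_analysis.
From mathcomp Require Import finmap lra.

(** Suppose that [u] lies in every nonexpansive half-space. Then for every unit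
    vector [v] with [<u, v> >= 0] the half-space [H_v] is expansive: for some
    [e > 0], two points whose orbits stay [e]-close along [H_v] are equal. From
    this [X] is shown to be finite.

    The constant [e] can be chosen independently of [v]
    ([separating_half_space]), and then compactness of [X * X] replaces the
    half-space by a finite set [F] of times in it ([separating_finite]):
    [e]-closeness along [F] forces [e]-closeness at time 0, hence
    [e]-closeness along [g + F] forces it at time [g]. By compactness of the
    unit sphere these finite sets are bounded and point strictly backwards, by
    a margin [tau] independent of [v], and they exist for all directions with
    [<u, v> >= - tau] ([uniform_forcing]).

    Consider two points that are [e]-close at the times of a large ball
    [B(c, r)]. At a point [g] just outside the ball, in a direction [g - c] that
    makes a not too obtuse angle with [u], the set [g + F] lies inside the ball,
    so the points are [e]-close at time [g] as well. The ball
    [B(c + t u, r + tau t / 2)] leaves [B(c, r)] only in such directions, so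
    closeness spreads to it ([close_on_grow]). After [n] steps the centre has
    moved by [n t u] and the radius has grown linearly in [n]. In particular,
    closeness on a ball of fixed radius around [- n t u] implies closeness on a
    ball around the origin whose radius tends to infinity with [n].

    All integer points of a ball of fixed radius fit, after an integral
    translation, into one finite window [W] ([finite_window]), and [X] is
    covered by finitely many, say [m], sets of points that are mutually
    [e]-close along [W] ([window_cover]). If [X] had [m + 1] distinct points,
    choose [n] so large that any two of them are separated at some time in the
    ball around the origin reached from [- n t u]. Two of the [m + 1] points,
    moved by the translation, fall into the same set of the cover, so they are
    close on the ball around [- n t u], hence on the ball around the origin: a
    contradiction ([finite_of_forcing_cone]). This extends the classical
    argument that a positively expansive homeomorphism of a compact space lives
    on a finite space. *)

Set Implicit Arguments.
Unset Strict Implicit.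
Unset Printing Implicit Defensive.

Import Order.TTheory GRing.Theory Num.Theory.
Import numFieldNormedType.Exports.
Local Open Scope classical_set_scope.
Local Open Scope ring_scope.

(** * Euclidean geometry of integer vectors *)
Section Euclid.
Context {R : realType} {d : nat}.
Implicit Types (u v w : 'rV[R]_d) (a : R) (k : 'rV[int]_d).

Definition ivec k : 'rV[R]_d := map_mx intr k.
Definition enorm u : R := Num.sqrt (dot u u).

Lemma dotC u v : dot u v = dot v u.
Proof. by apply: eq_bigr => i _; rewrite mulrC. Qed.

Lemma dotDl u v w : dot (u + v) w = dot u w + dot v w.
Proof. by rewrite -big_split; apply: eq_bigr => i _; rewrite mxE mulrDl. Qed.

Lemma dotZl a u w : dot (a *: u) w = a * dot u w.
Proof. by rewrite mulr_sumr; apply: eq_bigr => i _; rewrite mxE mulrA. Qed.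

Lemma dotNl u w : dot (- u) w = - dot u w.
Proof. by rewrite -scaleN1r dotZl mulN1r. Qed.

Lemma dotDr u v w : dot w (u + v) = dot w u + dot w v.
Proof. by rewrite !(dotC w) dotDl. Qed.

Lemma dotZr a u w : dot w (a *: u) = a * dot w u.
Proof. by rewrite !(dotC w) dotZl. Qed.

Lemma dotNr u w : dot w (- u) = - dot w u.
Proof. by rewrite !(dotC w) dotNl. Qed.

Lemma dot_ge0 u : 0 <= dot u u.
Proof. by apply: sumr_ge0 => i _; rewrite -expr2 sqr_ge0. Qed.

Lemma sqr_coord_le_dot u i : u ord0 i ^+ 2 <= dot u u.
Proof.
rewrite /dot (bigD1 i)//= -expr2 lerDl.
by apply: sumr_ge0 => j _; rewrite -expr2 sqr_ge0.
Qed.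

Lemma sqr_enorm u : enorm u ^+ 2 = dot u u.
Proof. by rewrite sqr_sqrtr// dot_ge0. Qed.

Lemma coord_le_enorm u i : `|u ord0 i| <= enorm u.
Proof. by rewrite -sqrtr_sqr ler_sqrt ?dot_ge0// sqr_coord_le_dot. Qed.

Lemma enorm_gt0 u : u != 0 -> 0 < enorm u.
Proof.
move=> u0; rewrite lt_neqAle sqrtr_ge0 andbT; apply: contraNN u0 => /eqP n0.
apply/eqP/rowP => i; rewrite mxE; apply/eqP.
by rewrite -normr_le0 n0 coord_le_enorm.
Qed.

(** A weak form of the Cauchy-Schwarz inequality: the constant only has to be
    independent of [v]. *)
Lemma dot_le_enorm u : exists2 A, 0 <= A & forall v, dot u v <= A * enorm v.
Proof.
exists (\sum_(i < d) `|u ord0 i|); first exact: sumr_ge0.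
move=> v; rewrite mulr_suml; apply: ler_sum => i _.
by rewrite (le_trans (ler_norm _))// normrM ler_wpM2l// coord_le_enorm.
Qed.

Lemma dot_continuous u : continuous (dot u).
Proof.
apply: (continuous_big (@add_continuous R)) => i _ v.
by apply: continuousM; [exact: cst_continuous|exact: coord_continuous].
Qed.

Lemma dot_near_lt u v a : dot u v < a -> \forall w \near v, dot u w < a.
Proof.
by apply: (@cvgr_lt R _ (nbhs v) _ (dot u)); exact: dot_continuous.
Qed.

Lemma ivecD k1 k2 : ivec (k1 + k2) = ivec k1 + ivec k2.
Proof. by rewrite /ivec map_mxD. Qed.

Lemma ivecZ n k : ivec (k *+ n) = n%:R *: ivec k.
Proof. by rewrite /ivec raddfMn/= scaler_nat. Qed.

Lemma ivec_neg v : v != 0 -> exists k, dot (ivec k) v < 0.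
Proof.
move=> /eqP v0.
have [i vi] : exists i, v ord0 i != 0.
  apply: contrapT => /forallNP h; apply: v0; apply/rowP => i; rewrite mxE.
  by apply/eqP/negPn/negP => /h.
have dotE z : dot (ivec (z *: delta_mx 0 i)) v = z%:~R * v ord0 i.
  rewrite /dot (bigD1 i)//= !mxE !eqxx mulr1 big1 ?addr0// => j ji.
  by rewrite !mxE (negbTE ji) andbF mulr0 mul0r.
move: vi; rewrite neq_lt => /orP[vi|vi].
  by exists (1 *: delta_mx 0 i); rewrite dotE mul1r.
by exists (-1 *: delta_mx 0 i); rewrite dotE mulN1r oppr_lt0.
Qed.

(** A large multiple of an integer vector pointing strictly into [H_v]
    dominates the finitely many numbers [<g, v>]. *)
Lemma exists_deep_shift v (G : {fset 'rV[int]_d}) : v != 0 ->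
  exists h, forall g, g \in G -> dot (ivec (h + g)) v <= 0.
Proof.
move=> /ivec_neg[k kv].
have /filter_ex[n Hn] : \forall n \near \oo,
    (\bigcap_(g in [set` G]) [set n | dot (ivec (k *+ n + g)) v <= 0]) n.
  apply: filter_bigI => g _; near=> n.
  rewrite /= ivecD ivecZ dotDl dotZl.
  have : `|dot (ivec g) v| / - dot (ivec k) v <= n%:R by near: n;
    exact: nbhs_infty_ger.
  rewrite ler_pdivrMr ?oppr_gt0// mulrN.
  by have := ler_norm (dot (ivec g) v); lra.
by exists (k *+ n).
Unshelve. all: by end_near. Qed.

Definition iball (c : 'rV[R]_d) (r : R) : set 'rV[int]_d :=
  [set g | dot (ivec g - c) (ivec g - c) <= r ^+ 2].

(** Rounding the centre [c] to an integer vector changes each coordinate by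
    less than 1, so a cube of side about [2 r] serves for all centres. *)
Lemma finite_window (r : R) : 0 <= r -> exists W : {fset 'rV[int]_d},
  forall c, exists h, forall g, iball c r g -> g - h \in W.
Proof.
move=> r0; have rM := archi_boundP r0; set M := Num.bound r in rM.
pose N := (2 * M + 1).+1.
exists [fset k in [seq map_mx (fun i : 'I_N => Posz i) a | a : 'rV['I_N]_d]]%fset.
move=> c; pose h := map_mx (fun a => Num.floor a - Posz M) c; exists h => g gc.
have gh i : 0 <= (g - h) ord0 i < Posz N.
  have gi : `|(g ord0 i)%:~R - c ord0 i| <= r.
    have := sqr_coord_le_dot (ivec g - c) i; rewrite !mxE => /le_trans/(_ gc).
    by rewrite -[X in X <= _]real_normK ?num_real// ler_pXn2r// nnegrE.
  rewrite !mxE; move: gi; rewrite ler_norml => /andP[gi1 gi2].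
  have := floor_le (c ord0 i); have := floorD1_gt (c ord0 i); rewrite intrD => f1 f2.
  rewrite -(ler_int R) -(ltr_int R) !intrD !mulrNz !intrD !mulrNz.
  rewrite -!pmulrn /N -[(2 * M + 1).+1]addn1 !natrD natrM.
  by apply/andP; split; lra.
rewrite inE/=; apply/mapP.
exists (\row_i (inord (absz ((g - h)%R ord0 i)) : 'I_N)).
  by rewrite mem_enum.
apply/rowP => i; rewrite [RHS]mxE [in RHS]mxE; case/andP: (gh i) => g0 gN.
by rewrite inordK ?gez0_abs// -ltz_nat gez0_abs.
Qed.

Lemma compact_unit_sphere : compact (@unit_sphere R d).
Proof.
apply: bounded_closed_compact.
  exists 1; split => // x x1 v /= v1.
  rewrite (le_trans _ (ltW x1))// /Num.norm/= mx_normrE.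
  apply: bigmax_le => // -[i j] _ /=.
  by rewrite -v1 (ord1 i) coord_le_enorm.
rewrite (_ : unit_sphere (d:=d) = (fun v : 'rV[R]_d => dot v v) @^-1` [set 1]).
  apply: preimage_closed; last exact: closed_eq.
  move=> v _; move: v; apply: (continuous_big (@add_continuous R)) => i _ v.
  by apply: continuousM; exact: coord_continuous.
apply/seteqP; split => v /=.
  by move=> v1; rewrite -sqr_enorm /enorm v1 expr1n.
by rewrite /unit_sphere/= => ->; rewrite sqrtr1.
Qed.

End Euclid.

(** * Compactness and the metric *)

(** The Heine-Borel property for spaces without a distinguished point: the
    finite subfamilies of [D] are directed by inclusion, and near each point of
    [K] all sufficiently large ones cover. *)
Lemma compact_fset_cover (S : topologicalType) (K : set S) (I : choiceType)
    (D : set I) (f : I -> set S) :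
  compact K -> (forall i, D i -> open (f i)) ->
  K `<=` \bigcup_(i in D) f i ->
  exists2 F : {fset I}, [set` F] `<=` D & K `<=` \bigcup_(i in [set` F]) f i.
Proof.
move=> /compact_near_coveringP cK fo Kf.
pose G : set_system {fset I} := filter_from [set F : {fset I} | [set` F] `<=` D]
  (fun F => [set F' : {fset I} | [set` F'] `<=` D /\ (F `<=` F')%fset]).
have FG : Filter G.
  apply: filter_from_filter; first by exists fset0 => i.
  move=> F1 F2 /= F1D F2D; exists (F1 `|` F2)%fset => /=.
    by move=> i /=; rewrite inE => /orP[/F1D|/F2D].
  by move=> F' /= [F'D]; rewrite fsubUset => /andP[].
have [|F /= FD cov] := cK _ G (fun F x => exists2 i, i \in F & f i x) FG.
  move=> x Kx; have [i Di fxi] := Kf x Kx.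
  exists (f i, [set F' : {fset I} | i \in F']) => /=.
    split; first by apply: open_nbhs_nbhs; split => //; exact: fo.
    exists [fset i]%fset => /= [j|F' /= [_]]; first by rewrite /= inE => /eqP ->.
    by rewrite fsub1set.
  by move=> [y F'] /= [fiy iF']; exists i.
exists F => // x Kx; have [|i iF fxi] := cov F _ x Kx; last by exists i.
by split.
Qed.

Section Metric.
Context {R : realType} {X : metricType R}.

Lemma mdist_lipschitz (x y x' y' : X) :
  `|mdist x y - mdist x' y'| <= mdist x x' + mdist y y'.
Proof.
have h (a b a' b' : X) : mdist a b - mdist a' b' <= mdist a a' + mdist b b'.
  rewrite lerBlDr (le_trans (metric_triangle a a' b))//.
  rewrite (le_trans (lerD (lexx _) (metric_triangle a' b' b)))//.
  by rewrite (metric_sym b'); lra.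
rewrite ler_norml h andbT lerNl opprB (le_trans (h _ _ _ _))//.
by rewrite (metric_sym x') (metric_sym y').
Qed.

Lemma mdist_continuous : continuous (fun p : X * X => mdist p.1 p.2).
Proof.
move=> [x y]; apply/cvgrPdist_lt => e e0.
have e2 : 0 < e / 2 by rewrite divr_gt0.
exists (ball x (e / 2), ball y (e / 2)) => /=.
  by split; exact: nbhsx_ballx.
move=> [x' y'] [/=]; rewrite !ballEmdist/= => xx' yy'.
by rewrite (le_lt_trans (mdist_lipschitz _ _ _ _))//; lra.
Qed.

End Metric.

(** * Closeness along a set of times *)
Section Action.
Context {R : realType} {d : nat} {X : metricType R} (T : Zd_action d X).
Implicit Types (e t r tau : R) (u v c : 'rV[R]_d).
Implicit Types (A : set 'rV[int]_d) (g h : 'rV[int]_d) (x y : X).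

Definition close_on e A x y :=
  forall g, A g -> mdist (T g x) (T g y) <= e.

Definition separating e A := forall x y, close_on e A x y -> x = y.

(** By equivariance, a forcing set carries closeness at the times [g + F] over to
    the time [g]; this is the step by which closeness spreads. *)
Definition forcing e (F : {fset 'rV[int]_d}) :=
  forall x y, close_on e [set` F] x y -> mdist x y <= e.

Lemma act_mdist_continuous g :
  continuous (fun p : X * X => mdist (T g p.1) (T g p.2)).
Proof.
have Tg : continuous (T g) by case: (act_homeo T g).
move=> [x y].
apply: (@continuous_comp _ _ _ (fun p : X * X => (T g p.1, T g p.2))
  (fun p : X * X => mdist p.1 p.2)); last exact: mdist_continuous.
apply: cvg_pair; apply: cvg_comp; by [exact: cvg_fst|exact: cvg_snd|exact: Tg].
Qed.

(** The pairs at distance at least [delta] form a compact set, which is covered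
    by the open sets of pairs that some time of [A] moves more than [e] apart. *)
Lemma separating_finite e A delta : compact [set: X] -> separating e A ->
  0 < delta -> exists2 F : {fset 'rV[int]_d}, [set` F] `<=` A &
    forall x y, close_on e [set` F] x y -> mdist x y < delta.
Proof.
move=> cX sepA delta0.
have : compact [set p : X * X | delta <= mdist p.1 p.2].
  have cXX : compact ([set: X] `*` [set: X]) by exact: compact_setX.
  apply: (subclosed_compact _ cXX); last by [].
  apply: (@preimage_closed _ _ (fun p : X * X => mdist p.1 p.2)
    [set r | delta <= r]); last exact: closed_ge.
  by move=> p _; exact: mdist_continuous.
move=> /(@compact_fset_cover _ _ _ A
  (fun g => [set p : X * X | e < mdist (T g p.1) (T g p.2)])); case.
- move=> g _.
  apply: (@open_comp _ _ (fun p : X * X => mdist (T g p.1) (T g p.2))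
    [set r | e < r]); last exact: open_gt.
  by move=> p _; exact: act_mdist_continuous.
- move=> [x y] /= dxy; apply: contrapT => nc.
  suff xy : x = y by move: dxy; rewrite xy mdistxx leNgt delta0.
  apply: sepA => g Ag; rewrite leNgt; apply/negP => egt.
  by apply: nc; exists g.
move=> F FA cov; exists F => //.
move=> x y cxy; rewrite ltNge; apply/negP => dxy.
have [g /= gF] := cov (x, y) dxy.
by rewrite ltNge cxy.
Qed.

(** The colouring [c] stands for a finite cover of [X] by sets of small diameter
    for the metric that takes the maximum over the times of [W]. *)
Lemma window_cover e (W : {fset 'rV[int]_d}) : compact [set: X] -> 0 < e ->
  exists n, exists c : X -> 'I_n, forall x y, c x = c y -> close_on e [set` W] x y.
Proof.
move=> cX e0.
pose U x := [set y | forall g, g \in W -> mdist (T g x) (T g y) < e / 2].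
have oU x : open (U x).
  rewrite openE => y Uxy; apply: filter_bigI => g gW.
  apply: open_nbhs_nbhs; split; last exact: Uxy.
  apply: (@open_comp _ _ (fun y => mdist (T g x) (T g y)) [set r | r < e / 2]);
    last exact: open_lt.
  move=> z _.
  apply: (@continuous_comp _ _ _ (fun y : X => (x, y))
    (fun p => mdist (T g p.1) (T g p.2))); last exact: act_mdist_continuous.
  by apply: cvg_pair; [exact: cvg_cst|exact: cvg_id].
have [||S _ cov] := @compact_fset_cover _ _ _ setT U cX.
- by move=> x _; exact: oU.
- by move=> x _; exists x => //= g _; rewrite mdistxx divr_gt0.
have /choice[f Hf] : forall x, exists s, s \in S /\ U s x.
  by move=> x; have [s sS Us] := cov x I; exists s.
exists (size S).+1, (fun x => inord (index (f x) S)) => x y.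
move=> /(congr1 val)/=; rewrite !inordK ?ltnS ?index_size// => fxy.
have {}fxy : f x = f y.
  by rewrite -(nth_index (f x) (Hf x).1) fxy nth_index//; exact: (Hf y).1.
move=> g gW; have := (Hf x).2 g gW; have := (Hf y).2 g gW.
rewrite -fxy (metric_sym _ (T g x)).
have := metric_triangle (T g x) (T g (f x)) (T g y); rewrite (metric_sym (T g x) _); lra.
Qed.

Definition ihalf v : set 'rV[int]_d := [set g | half_space v (ivec g)].

(** If [x] and [y] are [e]-close along [H_v], then [e]-separation along all times
    makes them [e']-close at the times deep inside [H_v]. Translated by a deep
    time, they are thus [e']-close along [H_v], hence equal. *)
Lemma separating_half_space e e' v : compact [set: X] -> v != 0 ->
  separating e setT -> 0 < e' -> separating e' (ihalf v) ->
  separating e (ihalf v).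
Proof.
move=> cX v0 sepe e'0 sepe' x y cxy.
have [G _ HG] := separating_finite cX sepe e'0.
have [h Hh] := exists_deep_shift G v0.
suff : T h x = T h y.
  move=> /(congr1 (T (- h))); by rewrite -!actD addNr !act0.
apply: sepe' => g gv; apply/ltW/HG => k kG.
rewrite -!actD; apply: cxy; rewrite /ihalf /half_space/=.
rewrite (_ : k + g + h = g + (h + k)); last by rewrite -addrA addrC -addrA.
rewrite ivecD dotDl.
by have := Hh k kG; move: gv; rewrite /ihalf /half_space/=; lra.
Qed.

(** In every direction [q] of a cone slightly larger than the half-space
    [<u, q> >= 0], there is a bounded forcing set lying backwards by a margin;
    one parameter [tau] controls the opening of the cone, the margin and the
    bound, so that the property becomes weaker as [tau] decreases. *)
Definition forcing_cone e u tau := forall q, q != 0 -> - tau * enorm q <= dot u q ->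
    exists2 F, forcing e F & forall f, f \in F ->
      dot (ivec f) q <= - tau * enorm q /\ dot (ivec f) (ivec f) <= tau^-1.

(** A forcing set chosen for a unit vector [v] serves all unit vectors near [v]
    once [tau] is small, and where [<u, v> < 0] the requirement is void near [v]
    for small [tau]. Compactness of the sphere makes [tau] uniform. *)
Lemma uniform_forcing e u :
  (forall v, unit_sphere v -> 0 <= dot u v ->
     exists2 F, [set` F] `<=` ihalf v & forcing e F) ->
  exists2 tau, 0 < tau & forcing_cone e u tau.
Proof.
move=> HF.
pose P tau v := - tau <= dot u v -> exists2 F, forcing e F &
  forall f, f \in F ->
    dot (ivec f) v <= - tau /\ dot (ivec f) (ivec f) <= tau^-1.
have /compact_near_coveringP cS := @compact_unit_sphere R d.
have : \forall tau \near 0^'+, @unit_sphere R d `<=` P tau.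
  apply: cS => v v1; have [uv|uv] := leP 0 (dot u v).
    have [F Fv forF] := HF v v1 uv.
    have : filter_prod (nbhs v) 0^'+ (\bigcap_(f in [set` F])
        [set p | dot (ivec f) p.1 <= - p.2 /\
                 dot (ivec f) (ivec f) <= (p.2 : R)^-1]).
      apply: filter_bigI => f fF.
      have fv : dot (ivec f) v < dot (ivec f) v / 2.
        by have := Fv f fF; rewrite /ihalf /half_space/=; lra.
      have f1 : 0 < (dot (ivec f) (ivec f) + 1 : R).
        by rewrite ltr_wpDl// dot_ge0.
      exists ([set w | dot (ivec f) w < dot (ivec f) v / 2],
        [set tau | 0 < tau /\ tau < - (dot (ivec f) v / 2) /\
           tau < (dot (ivec f) (ivec f) + 1)^-1]) => /=.
        split; first exact: dot_near_lt.
        near=> tau; split => //; split; near: tau; apply: nbhs_right_lt.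
          by rewrite oppr_gt0; lra.
        by rewrite invr_gt0.
      move=> [w tau] /= [fw [tau0 [tauv tauf]]]; split; first lra.
      move: tauf; rewrite -[ltRHS]div1r ltr_pdivlMr// mulrDr mulr1 => tauf.
      by rewrite -div1r ler_pdivlMr// mulrC; lra.
    by apply: filterS => p Hp _; exists F.
  exists ([set w | dot u w < dot u v / 2], [set tau | tau < - (dot u v / 2)]) => /=.
    split; first by apply: dot_near_lt; lra.
    by apply: nbhs_right_lt; lra.
  by move=> [w tau] /= uw tauv; rewrite /P; lra.
move=> Ptau.
have /filter_ex[tau [tau0 {}Ptau]] : \forall tau \near 0^'+,
    0 < tau /\ @unit_sphere R d `<=` P tau.
  by near=> tau; split=> //; near: tau.
exists tau => // q q0 uq.
have nq := enorm_gt0 q0.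
have := Ptau ((enorm q)^-1 *: q); rewrite /P /unit_sphere/= !dotZr !dotZl.
case.
- by rewrite -sqr_enorm mulrA -expr2 -exprMn mulVf ?gt_eqF// expr1n sqrtr1.
- by rewrite ler_pdivlMl// mulrC.
move=> F forF HF'; exists F => // f /HF'; rewrite dotZr ler_pdivrMl//.
by rewrite (mulrC (enorm q)).
Unshelve. all: by end_near. Qed.

(** * Spreading of closeness *)

(** A point of the new ball outside the old one lies in a direction of the
    forcing cone, seen from [c], because the new ball is moved along [u] and
    enlarged only slightly. A small step [t] keeps it so near to the old ball that
    the translated forcing set, whose margin beats its bounded length when [r] is
    large, falls back into the old ball. *)
Lemma close_on_grow e u tau K t r c x y : 0 < tau ->
  forcing_cone e u tau -> (forall q, dot u q <= K * enorm q) ->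
  0 < t -> t <= 1 / 2 -> 2 * t * K <= tau / 2 ->
  tau + tau^-1 ^+ 2 <= r ->
  close_on e (iball c r) x y ->
  close_on e (iball (c + t *: u) (r + tau * t / 2)) x y.
Proof.
move=> tau0 cone uA t0 t12 tA rtau cxy g.
rewrite /iball/= opprD addrA; move Eq: (ivec g - c) => q gq.
have [qr|qr] := leP (dot q q) (r ^+ 2); first by apply: cxy; rewrite /iball/= Eq.
have r0 : 0 <= r by rewrite (le_trans _ rtau)// addr_ge0 ?sqr_ge0// ltW.
have q0 : q != 0.
  apply: contraTneq qr => ->.
  by rewrite -leNgt /dot big1 ?sqr_ge0// => i _; rewrite mxE mul0r.
have rq : r < enorm q by rewrite -ltr_sqr ?nnegrE ?sqrtr_ge0// sqr_enorm.
move: gq; rewrite !dotDl !dotDr !dotNl !dotNr !dotZl !dotZr opprK (dotC q u) => gq.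
have := dot_ge0 u; have := sqr_enorm q; set n := enorm q in rq * => nq u0.
(* Expanding gq gives 2 t <u, q> >= n^2 - (r + tau t / 2)^2, up to the
   nonnegative term t^2 <u, u>; as n > r >= tau t, the right-hand side is at
   least - 2 t tau n, so q is a direction where forcing sets exist. *)
have uq : - tau * n <= dot u q.
  have tt0 : 0 < t * tau by rewrite mulr_gt0.
  have h1 := ltW qr; have h2 : t * tau * r <= t * tau * n by rewrite ler_pM2l// ltW.
  have h3 : t * tau * (t * tau) <= t * tau * r.
    rewrite ler_pM2l// (le_trans _ rtau)//.
    have : 0 <= tau^-1 ^+ 2 by rewrite sqr_ge0.
    by have : t * tau <= 1 * tau by [rewrite ler_pM2r//; lra]; lra.
  have h4 : 0 <= t * (t * dot u u) by rewrite !mulr_ge0// ltW.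
  have h5 : 0 <= t * tau * r by rewrite mulr_ge0// ltW.
  rewrite -(ler_pM2l t0); move: gq h1 h2 h3 h4 h5; rewrite -!nq; lra.
have [F forF HF] := cone q q0 uq.
(* It remains to see that the translate of F to g lies in the ball B(c, r). By
   gq and h1 the point q exceeds the sphere of radius r by less than what the
   backward step f regains: n^2 + 2 <f, q> + <f, f> is at most
   r^2 + t tau r + (t tau)^2 / 4 + (tau / 2) n - 2 tau n + tau^-1. *)
apply: forF => f /= fF; rewrite -!actD; apply: cxy; rewrite /iball/=.
rewrite ivecD -addrA Eq dotDl !dotDr (dotC q).
have [fq ff] := HF f fF.
have uAq := uA q.
rewrite -/n in fq uAq.
have h1 : t * dot u q <= tau / 4 * n.
  rewrite (@le_trans _ _ (t * (K * n)))// ?ler_pM2l// mulrA ler_wpM2r ?sqrtr_ge0//.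
  by lra.
have h2 : tau ^+ 2 + tau^-1 <= tau * r.
  rewrite -(ler_pM2l tau0) in rtau; apply: le_trans rtau.
  by rewrite mulrDr -expr2 [tau^-1 ^+ 2]expr2 mulrA divff ?gt_eqF// mul1r.
have h3 : tau * r <= tau * n by rewrite ler_pM2l// ltW.
have h4 : t * (tau * r) <= 1 / 2 * (tau * r) by rewrite ler_wpM2r// mulr_ge0// ltW.
have h5 : t * tau * (t * tau) <= tau ^+ 2.
  have : t * tau <= tau by rewrite ger_pMl//; lra.
  by move=> h; rewrite expr2 ler_pM// mulr_ge0// ltW.
have h6 : 0 <= t * (t * dot u u) by rewrite !mulr_ge0// ltW.
have h7 : 0 <= tau ^+ 2 by rewrite sqr_ge0.
by move: gq fq ff h1 h2 h3 h4 h5 h6 h7; rewrite -!nq; lra.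
Qed.

Lemma close_on_grow_iter e u tau K t r c x y n : 0 < tau ->
  forcing_cone e u tau -> (forall q, dot u q <= K * enorm q) ->
  0 < t -> t <= 1 / 2 -> 2 * t * K <= tau / 2 ->
  tau + tau^-1 ^+ 2 <= r ->
  close_on e (iball c r) x y ->
  close_on e (iball (c + (n%:R * t) *: u) (r + n%:R * (tau * t / 2))) x y.
Proof.
move=> tau0 cone uA t0 t12 tA rtau cxy.
elim: n => [|n IHn]; first by rewrite !mul0r scale0r !addr0.
rewrite -natr1 !mulrDl !mul1r scalerDl !addrA.
apply: (close_on_grow tau0 cone uA t0 t12 tA _ IHn).
by rewrite (le_trans rtau)// lerDl !mulr_ge0// ?ler0n// ltW// invr_gt0.
Qed.

(** A pigeonhole argument. The number [m] of colours depends only on a window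
    for balls of the fixed radius [r], whereas closeness on such a ball around
    [- n t u] spreads to an arbitrarily large ball around the origin. *)
Lemma finite_of_forcing_cone e u tau : compact [set: X] -> 0 < e ->
  separating e setT -> 0 < tau -> forcing_cone e u tau ->
  finite_set [set: X].
Proof.
move=> cX e0 sepe tau0 cone; apply: contrapT => infX.
have [A A0 uA] := dot_le_enorm u.
pose r := tau + tau^-1 ^+ 2.
have r0 : 0 <= r by rewrite addr_ge0 ?sqr_ge0// ltW.
pose t := Num.min (1 / 2) (tau / 4 / (A + 1)).
have A1 : 0 < A + 1 by lra.
have t0 : 0 < t by rewrite lt_min !divr_gt0.
have t12 : t <= 1 / 2 by rewrite ge_min lexx.
have tA : 2 * t * A <= tau / 2.
  have : t * (A + 1) <= tau / 4 by rewrite -ler_pdivlMr// ge_min lexx orbT.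
  by rewrite mulrDr; lra.
have [W HW] := @finite_window R d r r0.
have [m [col Hcol]] := window_cover W cX e0.
have [B _ mB] := infinite_set_fset m.+1 infX.
have /choice[g Hg] : forall p : B * B, exists g,
    p.1 != p.2 -> e < mdist (T g (val p.1)) (T g (val p.2)).
  move=> [a b] /=; have [_|ab] := eqVneq a b; first by exists 0.
  apply: contrapT => /forallNP ng; move/eqP: ab; apply; apply/val_inj/sepe => g _.
  by rewrite leNgt; apply/negP => ge; apply: (ng g).
pose rad (n : nat) := r + n%:R * (tau * t / 2).
have /filter_ex[n Hn] : \forall n \near \oo, forall p, iball 0 (rad n) (g p).
  apply: filter_forall => p; near=> n; rewrite /iball/= subr0.
  set D := dot _ _.
  have D0 : 0 <= D by exact: dot_ge0.
  have k0 : 0 < tau * t / 2 by rewrite divr_gt0// mulr_gt0.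
  have : (D + 1) / (tau * t / 2) <= n%:R by near: n; exact: nbhs_infty_ger.
  rewrite ler_pdivrMr// => Dn.
  have : D + 1 <= rad n by rewrite (le_trans Dn)// lerDr.
  by nra.
pose c := - ((n%:R * t) *: u).
have [h Hh] := HW c.
(* Points of the same colour after the shift by h are close on the ball around
   c, hence on the ball around 0, where distinct points of B are separated. *)
have colI : injective (fun a : B => col (T h (val a))).
  move=> a b /Hcol cab; apply/eqP/negP => /negP ab.
  have /close_on_grow_iter : close_on e (iball c r) (val a) (val b).
    by move=> k /Hh kW; rewrite -(subrK h k) !(actD T (k - h)); exact: cab.
  move=> /(_ u tau A t n tau0 cone uA t0 t12 tA (lexx _)).
  rewrite /c addNr => /(_ _ (Hn (a, b))).
  by rewrite leNgt (Hg (a, b)).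
have := leq_card _ colI; rewrite card_ord -cardfE => /(leq_trans mB).
by rewrite ltnn.
Unshelve. all: by end_near. Qed.

End Action.

Theorem theorem1p3 (R : realType) (d : nat) (hd : (1 <= d)%N)
    (X : metricType R) (hX : compact [set: X]) (hinf : infinite_set [set: X])
    (T : Zd_action d X) :
  \bigcap_(v in [set v : 'rV[R]_d | unit_sphere v /\
                                    nonexpansive T (half_space v)])
    half_space v = set0.
Proof.
rewrite -subset0 => u uH; apply: hinf.
have sep_half v : unit_sphere v -> 0 <= dot u v ->
    exists2 e, 0 < e & separating T e (ihalf v).
  move=> v1 uv; apply: contrapT => nsep.
  have /uH : unit_sphere v /\ nonexpansive T (half_space v).
    split=> // e e0; apply: contrapT => nxy; apply: nsep; exists e => // x y cxy.
    by apply: contrapT => xy; apply: nxy; exists x, y.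
  by rewrite /half_space/= ltNge uv.
(* Some unit vector v has <u, v> >= 0, since this holds for v or - v; it fixes
   the constant e used for all the other half-spaces. *)
have [v v1 uv] : exists2 v : 'rV[R]_d, unit_sphere v & 0 <= dot u v.
  pose v : 'rV[R]_d := delta_mx 0 (Ordinal hd).
  have vv : unit_sphere v.
    rewrite /unit_sphere/= /dot (bigD1 (Ordinal hd))//= !mxE !eqxx mulr1.
    rewrite big1 ?addr0 ?sqrtr1// => j jd.
    by rewrite !mxE (negbTE jd) mulr0.
  have [uv|uv] := leP 0 (dot u v); first by exists v.
  exists (- v); last by rewrite dotNr oppr_ge0 ltW.
  by rewrite /unit_sphere/= dotNl dotNr opprK.
have [e e0 sepv] := sep_half v v1 uv.
have sepe : separating T e setT by move=> x y cxy; apply: sepv => g _; exact: cxy.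
have [|tau tau0 cone] := @uniform_forcing _ _ _ T e u.
  move=> w w1 uw; have [e' e'0 sepw] := sep_half w w1 uw.
  have w0 : w != 0.
    apply/eqP => w0; move: w1; rewrite /unit_sphere/= w0 /dot big1; last first.
      by move=> i _; rewrite mxE mulr0.
    by rewrite sqrtr0 => /eqP; rewrite eq_sym oner_eq0.
  have := separating_half_space hX w0 sepe e'0 sepw.
  move=> /(separating_finite hX)/(_ e0)[F Fw HF].
  by exists F => // x y /HF/ltW.
exact: finite_of_forcing_cone hX e0 sepe tau0 cone.
Qed.
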